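(* Let $G$ be a finite group, $p$ a prime, and $\Delta$ a non-trivial minimal synthetic building for $G$ at $p$. Let $J,K$ be non-conjugate maximal subgroups of $G$ and let $H=J\cap K$. Suppose that (1) $\Delta^J$ and $\Delta^K$ are non-empty; (2) $\Delta^H$ is path-connected; (3) if $A\le G$ is a subgroup that properly contains $H$ then $A$ is one of $K$, $J$ or $G$; (4) the $G$-graph $\Gamma$ with vertex set $G/J\sqcup G/K$ and edge set $G/H$, where the edge $xH$ joins the vertices $xJ$ and $xK$, is a synthetic building for $G$ at $p$. Then $\Delta$ is $G$-equivariantly homotopy equivalent to $\Gamma$.
   Context: A $G$-simplicial complex is a finite (possibly empty) simplicial complex $\Delta$ with a simplicial action of the finite group $G$ such that the setwise stabilizer of each simplex fixes that simplex pointwise. For $H\le G$, $\Delta^H$ denotes the fixed point subcomplex. Contractible spaces are non-empty. A $G$-simplicial complex $\Delta$ is a synthetic building for $G$ at the prime $p$ if (1) $\Delta^P$ is $N_G(P)$-equivariantly contractible for every non-identity $p$-subgroup $P\le G$, and (2) the stabilizer of every simplex has order divisible by $p$. A synthetic building is non-trivial if it is not $G$-equivariantly homotopy equivalent to a single point. It is minimal if it has no proper $G$-invariant subcomplex that is also a synthetic building for $G$ at $p$. The $G$-graph $\Gamma$ in (4) is the unique $G$-graph (up to isomorphism) having a single edge as a set of orbit representatives, the ends of this edge having stabilizers $J$ and $K$ and the edge itself having stabilizer $H$. *)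

(* Defs.v *)
From mathcomp Require Import all_boot all_order all_algebra all_fingroup all_solvable.
From mathcomp Require Import classical_sets set_interval reals topology.

Set Implicit Arguments.
Unset Strict Implicit.
Unset Printing Implicit Defensive.

Import Order.TTheory GRing.Theory Num.Theory.
Import numFieldTopology.Exports.

(* Group actions follow the MathComp convention: [to x g] is a right action.
   A left action g.x is encoded as [to x g := g^-1.x], which changes neither
   stabilizers, fixed points, invariant subsets nor equivariant maps. *)

Section Complexes.
Local Open Scope group_scope.
Variables (gT : finGroupType) (G : {group gT}) (V : finType).
Implicit Types (to : action G V) (H : {set gT}) (X : {set {set V}}).

(* A finite simplicial complex is the set of its non-empty simplices; its
   vertices are the v with [set v] \in X, not necessarily all of V. *)
Definition simplicial_complex X : Prop :=
  finset.set0 \notin X /\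
  forall s t : {set V}, s \in X -> t \subset s -> t != finset.set0 -> t \in X.

Definition G_complex to X : Prop :=
  [/\ simplicial_complex X, [acts G, on X | to^*]
    & forall s, s \in X -> 'N(s | to) \subset 'C(s | to)].

Definition fixed_subcomplex to H X : {set {set V}} :=
  [set s in X | s \subset 'Fix_to(H)]%SET.

End Complexes.

(* A G-space: a subset of a topological space (with the subspace topology),
   together with the action on the ambient space. *)
Record gspace (gT : finGroupType) := GSpace {
  gs_ambient : topologicalType;
  gs_carrier : set gs_ambient;
  gs_act : gs_ambient -> gT -> gs_ambient }.

Arguments gs_carrier {gT} X _ : rename.
Arguments gs_act {gT X} x g%_g : rename.

Section Homotopy.
Local Open Scope classical_set_scope.
Local Open Scope ring_scope.
Variables (R : realType) (gT : finGroupType).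
Implicit Types (A : {set gT}) (X Y : gspace gT).

(* Only the values of f on gs_carrier X matter. *)
Definition equivariant_map A X Y (f : gs_ambient X -> gs_ambient Y) : Prop :=
  [/\ {within gs_carrier X, continuous f},
      (forall x, gs_carrier X x -> gs_carrier Y (f x))
    & forall g x, g \in A -> gs_carrier X x ->
        f (gs_act x g) = gs_act (f x) g].

Definition cylinder X : gspace gT :=
  @GSpace gT (R * gs_ambient X)%type (`[0, 1] `*` gs_carrier X)
    (fun tx g => (tx.1, gs_act tx.2 g)).

Definition equivariant_homotopic A X Y (f0 f1 : gs_ambient X -> gs_ambient Y)
    : Prop :=
  exists h : gs_ambient (cylinder X) -> gs_ambient Y,
    equivariant_map A h /\
    forall x, gs_carrier X x -> h (0, x) = f0 x /\ h (1, x) = f1 x.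

Definition equivariant_homotopy_equivalent A X Y : Prop :=
  exists (f : gs_ambient X -> gs_ambient Y) (f' : gs_ambient Y -> gs_ambient X),
    [/\ equivariant_map A f, equivariant_map A f',
        equivariant_homotopic A (f' \o f) idfun
      & equivariant_homotopic A (f \o f') idfun].

Definition point_space : gspace gT :=
  @GSpace gT R [set 0] (fun x _ => x).

Definition equivariantly_contractible A X : Prop :=
  equivariant_homotopy_equivalent A X point_space.

Definition path_connected (T : topologicalType) (S : set T) : Prop :=
  forall x y, S x -> S y ->
    exists gamma : R -> T,
      [/\ {within `[0, 1], continuous gamma},
          (forall t : R, 0 <= t <= 1 -> S (gamma t)), gamma 0 = x & gamma 1 = y].

(* Geometric realization in barycentric coordinates. *)
Definition realization (V : finType) (X : {set {set V}})
    : set {ptws V -> R} :=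
  [set x : {ptws V -> R} |
    [/\ forall v, 0 <= x v, \sum_v x v = 1 & [set v | x v != 0]%SET \in X]].

(* The linear extension of the vertex action: the vertex [v] is sent to
   [to v g], so the coordinate of the image at [v] is that at [to v g^-1]. *)
Definition realization_space (V : finType) (to : V -> gT -> V)
    (X : {set {set V}}) : gspace gT :=
  @GSpace gT {ptws V -> R} (realization X) (fun x g v => x (to v g^-1%g)).

End Homotopy.

Arguments point_space R gT : clear implicits.
Arguments realization R {V} X _.
Arguments realization_space R {gT V} to X.

Section SyntheticBuildings.
Local Open Scope group_scope.
Variables (R : realType) (gT : finGroupType) (G : {group gT}) (p : nat).
Variables (V : finType) (to : action G V).
Implicit Type X : {set {set V}}.

Definition synthetic_building X : Prop :=
  [/\ G_complex to X,
      (forall P : {group gT}, P \subset G -> p.-group P -> P :!=: 1 ->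
         equivariantly_contractible R 'N_G(P)
           (realization_space R to (fixed_subcomplex to P X)))
    & (forall s, s \in X -> p %| #|'N(s | to)|)].

Definition nontrivial_synthetic_building X : Prop :=
  ~ equivariant_homotopy_equivalent R G
      (realization_space R to X) (point_space R gT).

(* Being a G-invariant subcomplex is part of [synthetic_building X']. *)
Definition minimal_synthetic_building X : Prop :=
  synthetic_building X /\
  forall X', X' \proper X -> ~ synthetic_building X'.

End SyntheticBuildings.

Section CosetGraph.
Local Open Scope group_scope.
Variables (gT : finGroupType).
Implicit Types (G : {group gT}) (J K : {set gT}).

(* Left translation of cosets, as a right action. *)
Definition coset_act (v : {set gT} + {set gT}) (g : gT)
    : {set gT} + {set gT} :=
  match v with
  | inl A => inl (g^-1 *: A)
  | inr B => inr (g^-1 *: B)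
  end.

Lemma coset_act_is_action G : is_action G coset_act.
Proof.
split=> [g [A|A] [B|B] //= [] | [A|A] a b _ _ /=]; last 2 first.
- by rewrite invMg lcosetM.
- by rewrite invMg lcosetM.
- by move/lcoset_inj->.
- by move/lcoset_inj->.
Qed.

Definition coset_action G : action G ({set gT} + {set gT})%type :=
  Action (coset_act_is_action G).

(* When J and K are subgroups, two elements x, y of G define the same edge
   exactly when they define the same left coset of J :&: K, so that the edges
   are indexed by G / (J :&: K). *)
Definition coset_graph G J K : {set {set ({set gT} + {set gT})}} :=
  [set [set inl A] | A in lcosets J G]%SET
  :|: [set [set inr B] | B in lcosets K G]%SET
  :|: [set [set inl (x *: J); inr (x *: K)] | x in G]%SET.

End CosetGraph.

(* Main.v *)
(** A shortest edge path in [Delta] from a vertex fixed by [J] to a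
    vertex fixed by [K], with all vertices fixed by [H], has interior vertices
    with stabilizer exactly [H], and its vertices lie in distinct [G]-orbits:
    two interior vertices in one orbit differ by some [g] normalizing [H], such
    a [g] is a product [j * k] of elements of [J] and [K] normalizing [H], and
    cutting out the part between the two vertices and moving the remaining
    pieces by [j] and [k^-1] gives a shorter path. (No vertex of [Delta] is fixed by
    [G], for it would be a synthetic building by itself.) The [G]-orbit of the
    path is therefore a subdivision of the coset graph, hence [G]-homeomorphic
    to it, hence a synthetic building, hence all of [Delta] by minimality.

    The [G]-homeomorphism comes from compactness: both realizations are
    Hausdorff quotients of G x [0, 1] by the same equivalence relation. *)

Require Import Defs.
From mathcomp Require Import all_boot all_order all_algebra all_fingroup all_solvable.
From mathcomp Require Import boolp classical_sets functions set_interval.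
From mathcomp Require Import reals topology normedtype.
From mathcomp Require Import archimedean zify ring lra.

Import Order.TTheory GRing.Theory Num.Theory.
Import numFieldTopology.Exports numFieldNormedType.Exports.

Set Implicit Arguments.
Unset Strict Implicit.
Unset Printing Implicit Defensive.

(** * Equivariant homeomorphisms *)

Section GSpaces.
Local Open Scope classical_set_scope.
Local Open Scope ring_scope.
Variables (R : realType) (gT : finGroupType).
Implicit Types (A : {set gT}) (X Y Z : gspace gT).

Definition equivariant_homeo A X Y
    (f : gs_ambient X -> gs_ambient Y) (f' : gs_ambient Y -> gs_ambient X) : Prop :=
  [/\ equivariant_map A f, equivariant_map A f',
      (forall x, gs_carrier X x -> f' (f x) = x)
    & (forall y, gs_carrier Y y -> f (f' y) = y)].

Lemma within_comp (S T U : topologicalType) (B : set S) (C : set T)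
    (f : S -> T) (g : T -> U) :
  {within B, continuous f} -> (forall x, B x -> C (f x)) ->
  {within C, continuous g} -> {within B, continuous (g \o f)}.
Proof.
move=> /subspace_continuousP cf fBC /subspace_continuousP cg.
apply/subspace_continuousP => x Bx W nW.
have nW' : nbhs x (fun y => B y -> C (f y) -> W (g (f y))).
  exact: cf _ Bx _ (cg _ (fBC _ Bx) _ nW).
by apply: filterS nW' => y BW By; exact: BW By (fBC _ By).
Qed.

Lemma within_cst (S T : topologicalType) (B : set S) (y : T) :
  {within B, continuous (fun=> y)}.
Proof. by apply: continuous_subspaceT => x; exact: cvg_cst. Qed.

Lemma within_snd (S T : topologicalType) (B : set S) (C : set T) :
  {within B `*` C, continuous (@snd S T)}.
Proof. by apply: continuous_subspaceT => x; exact: cvg_snd. Qed.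

Lemma within_pair_map (S T U : topologicalType) (B : set S) (C : set T)
    (f : T -> U) :
  {within C, continuous f} ->
  {within B `*` C, continuous (fun x : S * T => (x.1, f x.2))}.
Proof.
move=> cf; apply/subspace_continuousP => x BCx.
apply: cvg_pair.
  have /subspace_continuousP : {within B `*` C, continuous (@fst S T)}.
    by apply: continuous_subspaceT => y; exact: cvg_fst.
  exact.
have /subspace_continuousP := within_comp (@within_snd _ _ B C) (fun x => @proj2 _ _) cf.
exact.
Qed.

Lemma equivariant_comp A X Y Z
    (f : gs_ambient X -> gs_ambient Y) (g : gs_ambient Y -> gs_ambient Z) :
  equivariant_map A f -> equivariant_map A g -> equivariant_map A (g \o f).
Proof.
case=> cf fXY fA [cg gYZ gA]; split.
- exact: within_comp cf fXY cg.
- by move=> x /fXY/gYZ.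
- by move=> a x aA Xx /=; rewrite fA // gA //; exact: fXY.
Qed.

Lemma homotopic_of_eq A X (f : gs_ambient X -> gs_ambient X) :
  (forall x, gs_carrier X x -> f x = x) ->
  equivariant_homotopic R A f idfun.
Proof.
move=> fid; exists (fun tx => tx.2); split; last by move=> x /fid ->.
by split=> //= [|x []//]; exact: within_snd.
Qed.

Lemma homeo_homotopy_equivalent A X Y
    (f : gs_ambient X -> gs_ambient Y) (f' : gs_ambient Y -> gs_ambient X) :
  equivariant_homeo A f f' -> equivariant_homotopy_equivalent R A X Y.
Proof.
by case=> ef ef' fK f'K; exists f, f'; split=> //; apply: homotopic_of_eq.
Qed.

(** On [X] the homotopy is conjugated by the homeomorphism. On [Z] it is reused unchanged, because
    the two homeomorphisms cancel on the carrier of [Y]. *)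
Lemma homeo_homotopy_trans A X Y Z
    (f : gs_ambient X -> gs_ambient Y) (f' : gs_ambient Y -> gs_ambient X) :
  equivariant_homeo A f f' ->
  equivariant_homotopy_equivalent R A Y Z -> equivariant_homotopy_equivalent R A X Z.
Proof.
case=> ef ef' fK f'K [a [b [ea eb [h [eh h01]] [k [ek k01]]]]].
exists (a \o f), (f' \o b); split; try exact: equivariant_comp.
- exists (fun tx => f' (h (tx.1, f tx.2))); split; last first.
    move=> x Xx; have [_ fXY _] := ef.
    by have [/= -> ->] := h01 _ (fXY _ Xx); split=> //=; rewrite fK.
  have ef2 : @equivariant_map _ A (cylinder R X) (cylinder R Y)
      (fun tx => (tx.1, f tx.2)).
    case: ef => cf fXY fA; split=> /=.
    - exact: within_pair_map.
    - by move=> x [x1 /fXY].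
    - by move=> g x gA [_ Xx]; rewrite fA.
  exact: equivariant_comp (equivariant_comp ef2 eh) ef'.
- exists k; split=> // z Zz; have [/= -> ->] := k01 _ Zz; split=> //=.
  by case: eb => _ bZY _; rewrite f'K //; exact: bZY.
Qed.

(** * Spaces covered by the translates of one arc *)

Section ArcCovers.
Variable G : {group gT}.

(* [P g] is the translate by [g] of the arc [P 1]. *)
Definition arc_cover X (P : gT -> R -> gs_ambient X) : Prop :=
  [/\ hausdorff_space (gs_ambient X), (forall g, g \in G -> continuous (P g)),
      (forall x, gs_carrier X x <->
         exists g t, [/\ g \in G, 0 <= t <= 1 & x = P g t])
    & (forall g h t, g \in G -> h \in G -> gs_act (P g t) h = P (g * h)%g t)].

(* A continuous bijection out of a compact space onto a Hausdorff one is a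
   homeomorphism: closed sets pull back to images of compact sets. *)
Lemma arc_cover_map X Y P Q : @arc_cover X P -> @arc_cover Y Q ->
  (forall g h t u, g \in G -> h \in G -> 0 <= t <= 1 -> 0 <= u <= 1 ->
     P g t = P h u -> Q g t = Q h u) ->
  exists f : gs_ambient X -> gs_ambient Y, equivariant_map G f /\
    forall g t, g \in G -> 0 <= t <= 1 -> f (P g t) = Q g t.
Proof.
move=> [hX cP covP actP] [hY cQ covQ actQ] PQ.
have [f fE] : {f : gs_ambient X -> gs_ambient Y |
    forall g t, g \in G -> 0 <= t <= 1 -> f (P g t) = Q g t}.
  have Px x : exists y, forall g t, g \in G -> 0 <= t <= 1 -> x = P g t -> y = Q g t.
    have [[g [t [gG t01 ->]]]|nx] :=
        pselect (exists g t, [/\ g \in G, 0 <= t <= 1 & x = P g t]).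
      by exists (Q g t) => h u hG u01; exact: PQ.
    (* [Q 1 0] is a default value for points off the carrier. On the carrier, the hypothesis on [P]
       and [Q] makes the choice of [(g, t)] irrelevant. *)
    by exists (Q 1%g 0) => g t gG t01 xE; case: nx; exists g, t.
  by exists (fun x => projT1 (cid (Px x))) => g t gG t01; case: cid => /= y; exact.
exists f; split=> //; split; last 2 first.
- move=> x /covP[g [t [gG t01 ->]]]; apply/covQ; exists g, t.
  by rewrite fE.
- move=> h x hG /covP[g [t [gG t01 ->]]].
  by rewrite actP // !fE ?groupM // actQ.
apply/continuous_closedP => C clC; apply/closed_subspaceP.
(* On the carrier this is the preimage of [C]. It is closed, as a finite union of compact sets in a
   Hausdorff space. *)
exists (\bigcup_(g in [set` G]) (P g @` (`[0, 1] `&` Q g @^-1` C))).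
  apply: closed_bigcup => // g gG.
  apply: compact_closed => //; apply: continuous_compact.
    by apply: continuous_subspaceT; exact: cP.
  apply: compact_closedI; first exact: segment_compact.
  by have /continuous_closedP := cQ g gG; exact.
apply/seteqP; split=> x /= [].
  move=> [g gG [t [t01 Ct] <-]] Xx; split=> //.
  by change (C (f (P g t))); rewrite fE.
move=> Cfx Xx; split=> //; have /covP[g [t [gG t01 xE]]] := Xx.
exists g => //; exists t; last by rewrite xE.
by split; [rewrite /= in_itv | move: Cfx; change (C (f x) -> C (Q g t)); rewrite xE fE].
Qed.

Lemma arc_cover_homeo X Y P Q : @arc_cover X P -> @arc_cover Y Q ->
  (forall g h t u, g \in G -> h \in G -> 0 <= t <= 1 -> 0 <= u <= 1 ->
     P g t = P h u <-> Q g t = Q h u) ->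
  exists f f', @equivariant_homeo G X Y f f'.
Proof.
move=> cX cY PQ.
have [g h t u gG hG t01 u01|f [ef fE]] := arc_cover_map cX cY.
  by move=> /PQ; exact.
have [g h t u gG hG t01 u01|f' [ef' fE']] := arc_cover_map cY cX.
  by move=> /PQ; exact.
exists f, f'; split=> //.
- by case: cX => _ _ covX _ x /covX[g [t [gG t01 ->]]]; rewrite fE ?fE'.
- by case: cY => _ _ covX _ x /covX[g [t [gG t01 ->]]]; rewrite fE' ?fE.
Qed.

End ArcCovers.

End GSpaces.

(** * Orbits of a path *)

Lemma continuous_ptws (T U : topologicalType) (I : eqType) (f : T -> {ptws I -> U}) :
  (forall i, continuous (fun t => f t i)) -> continuous f.
Proof.
move=> cf t; apply/cvg_sup => i.
move=> A [?/= [[W oW <-]]] /= Wfi /filterS; apply; apply: (cf i).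
exact: open_nbhs_nbhs.
Qed.

Section VertexPoint.
Local Open Scope ring_scope.
Variables (R : realType) (V : finType) (a : V).

Lemma sum_delta : \sum_w (w == a)%:R = 1 :> R.
Proof. by rewrite (bigD1 a) //= eqxx big1 ?addr0 // => w /negPf->. Qed.

Lemma realization_vertex (X : {set {set V}}) :
  [set a]%SET \in X -> realization R X (fun v => (v == a)%:R).
Proof.
move=> aX; split; [by move=> v; rewrite ler0n|exact: sum_delta|].
rewrite (_ : finset _ = [set a]%SET) //; apply/setP => v; rewrite !inE.
by case: (v == a); rewrite ?oner_eq0 ?eqxx.
Qed.

End VertexPoint.

(** * Piecewise linear coordinates on a subdivided interval *)

Section Hat.
Local Open Scope ring_scope.
Variable R : realType.
Implicit Types (n i : nat) (t : R).

(** The barycentric coordinate at vertex [i] of the point at position [n * t] on a path with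
    vertices at [0, ..., n]. *)
Definition hat n i t : R := Num.max 0 (1 - `|n%:R * t - i%:R|).

Lemma hat_continuous n i : continuous (hat n i).
Proof.
move=> t; apply: (@continuous_max R _ (fun=> 0) (fun t => 1 - `|n%:R * t - i%:R|)).
  exact: cvg_cst.
apply: cvgB; first exact: cvg_cst.
by apply: cvg_norm; apply: cvgB; [apply: cvgMr; exact: cvg_id|exact: cvg_cst].
Qed.

Lemma hatE n i j t s : 0 <= s <= 1 -> n%:R * t = i%:R + s ->
  hat n j t = (1 - s) * (j == i)%:R + s * (j == i.+1)%:R.
Proof.
move=> s01 ntE; rewrite /hat ntE.
have [->|nji] := eqVneq j i.
  rewrite (ltn_eqF (ltnSn i)) ger0_norm; last by lra.
  by rewrite max_r /=; lra.
have [->|njiS] := eqVneq j i.+1.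
  rewrite -natr1 ler0_norm; last by lra.
  by rewrite max_r /=; lra.
rewrite max_l /=; first by lra.
(* Any other [j] is at distance at least 1 from [i + s], so its hat is truncated to 0. *)
move: nji; rewrite neq_ltn => /orP[ji|ij].
  have : (j.+1%:R : R) <= i%:R by rewrite ler_nat.
  by rewrite -natr1 => ?; rewrite ger0_norm; lra.
have : (i.+2%:R : R) <= j%:R by rewrite ler_nat ltn_neqAle eq_sym njiS.
by rewrite -2!natr1 => ?; rewrite ler0_norm; lra.
Qed.

(** The edge index is the integer part of [n * t], except at [t = 1], where the end of the last edge
    is taken: [i = n - 1], [s = 1]. The last clause says that vertex [i] has positive coordinate
    unless [t = 1]. *)
Lemma unit_interval_split n t : (0 < n)%N -> 0 <= t <= 1 ->
  exists i s, [/\ (i < n)%N, 0 <= s <= 1, n%:R * t = i%:R + s & t < 1 -> s < 1].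
Proof.
move=> n0 t01; have n0' : 0 < n%:R :> R by rewrite ltr0n.
have [t1|t1] := ltP t 1; last first.
  exists n.-1, 1; rewrite ltn_predL n0; split=> //; try lra.
  have -> : t = 1 by lra.
  by rewrite natr1 prednK // mulr1.
have nt0 : 0 <= n%:R * t by nra.
have /andP[le_nt lt_nt] := truncn_itv nt0.
rewrite -natr1 in lt_nt.
exists (Num.trunc (n%:R * t)), (n%:R * t - (Num.trunc (n%:R * t))%:R); split.
- by rewrite -(ltr_nat R); nra.
- by lra.
- by rewrite addrC subrK.
- by lra.
Qed.

Lemma sum_hat n i t s (F : nat -> R) : (i < n)%N -> 0 <= s <= 1 ->
  n%:R * t = i%:R + s ->
  \sum_(j < n.+1) hat n j t * F j = (1 - s) * F i + s * F i.+1.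
Proof.
move=> lt_in s01 ntE.
under eq_bigr => j _ do rewrite (hatE _ s01 ntE) mulrDl -!mulrA.
rewrite big_split /= -!mulr_sumr; congr (_ * _ + _ * _).
  rewrite (bigD1 (Ordinal (leqW lt_in))) //= eqxx mul1r big1 ?addr0 // => j.
  by rewrite -val_eqE /= => /negPf->; rewrite mul0r.
rewrite (bigD1 (Ordinal (lt_in : (i.+1 < n.+1)%N))) //= eqxx mul1r big1 ?addr0 // => j.
by rewrite -val_eqE /= => /negPf->; rewrite mul0r.
Qed.

(** The first moment of the hats, with weight [j] at vertex [j], equals [n * t] and so recovers
    [t]. *)
Lemma hat_inj n t u : (0 < n)%N -> 0 <= t <= 1 -> 0 <= u <= 1 ->
  (forall i, (i <= n)%N -> hat n i t = hat n i u) -> t = u.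
Proof.
move=> n0 t01 u01 tu.
have moment v : 0 <= v <= 1 -> \sum_(j < n.+1) hat n j v * j%:R = n%:R * v.
  case/(unit_interval_split n0) => i [s [lt_in s01 vE _]].
  by rewrite (sum_hat (fun j => j%:R) lt_in s01 vE) vE -natr1; ring.
apply: (@mulfI _ n%:R); first by rewrite pnatr_eq0 -lt0n.
rewrite -!moment //; apply: eq_bigr => j _; rewrite tu // -ltnS.
exact: ltn_ord.
Qed.

End Hat.

(** * The orbit of a path and its realization *)

Section GPath.
Local Open Scope ring_scope.
Variables (R : realType) (gT : finGroupType) (G : {group gT}).
Variables (V : finType) (to : action G V).
Implicit Types (J K : {group gT}) (n i j : nat) (v : nat -> V) (g h : gT).

Definition path_complex n v : {set {set V}} :=
  [set s : {set V} | (s != finset.set0) &&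
    [exists i : 'I_n, exists g in G, s \subset [set to (v i) g; to (v i.+1) g]]]%SET.

Lemma path_complexP n v (s : {set V}) :
  reflect (s != finset.set0 /\ exists i g,
             [/\ (i < n)%N, g \in G & s \subset [set to (v i) g; to (v i.+1) g]%SET])
          (s \in path_complex n v).
Proof.
rewrite inE; apply: (iffP andP) => -[s0].
  by case/existsP => i /existsP[g /andP[gG sE]]; split=> //; exists i, g.
move=> [i [g [lt_in gG sE]]]; split=> //.
by apply/existsP; exists (Ordinal lt_in); apply/existsP; exists g; rewrite gG.
Qed.

(* The vertices [v 0, ..., v n] lie in distinct orbits and have stabilizers
   [J] (for [i = 0]), [J :&: K] (for [0 < i < n]) and [K] (for [i = n]). *)
Definition G_path J K n v : Prop :=
  [/\ (0 < n)%N,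
      (forall i g, (i <= n)%N -> g \in G -> (to (v i) g == v i) =
         ((i < n)%N ==> (g \in J)) && ((0 < i)%N ==> (g \in K)))
    & (forall i j g, (i <= n)%N -> (j <= n)%N -> g \in G ->
         to (v i) g = v j -> i = j)].

(* At time [t] the arc is at position [n * t] along the translated path. *)
Definition arc n v g (t : R) : {ptws V -> R} :=
  fun w => \sum_(i < n.+1) hat n i t * (w == to (v i) g)%:R.

Lemma arc_continuous n v g : continuous (arc n v g).
Proof.
move=> t; move: t; apply: continuous_ptws => w t; rewrite /arc.
apply: (@cvg_big _ _ (@GRing.add R)); first exact: add_continuous.
move=> i _; apply: cvgM; [exact: hat_continuous|exact: cvg_cst].
Qed.

Lemma arcE n v g t i s w : (i < n)%N -> 0 <= s <= 1 -> n%:R * t = i%:R + s ->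
  arc n v g t w = (1 - s) * (w == to (v i) g)%:R + s * (w == to (v i.+1) g)%:R.
Proof. exact: (sum_hat (fun j => (w == to (v j) g)%:R)). Qed.

Lemma arc_act n v g h t : g \in G -> h \in G ->
  (fun w => arc n v g t (to w h^-1%g)) = arc n v (g * h)%g t.
Proof.
move=> gG hG; apply/funext => w; apply: eq_bigr => i _.
by rewrite actMin // -[in RHS](inj_eq (act_inj to h^-1%g)) actKin.
Qed.

Section WithPath.
Variables (J K : {group gT}) (n : nat) (v : nat -> V).
Hypothesis pv : G_path J K n v.

Lemma same_orbit_vertex i j g h : (i <= n)%N -> (j <= n)%N -> g \in G -> h \in G ->
  to (v i) g = to (v j) h -> i = j.
Proof.
case: pv => _ _ orb le_in le_jn gG hG e.
apply: (orb _ _ (g * h^-1)%g) => //; first by rewrite groupM ?groupV.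
by rewrite actMin ?groupV // e actKin.
Qed.

Lemma same_vertex i g h : g \in G -> h \in G ->
  (to (v i) g == to (v i) h) = (to (v i) (g * h^-1)%g == v i).
Proof.
move=> gG hG; rewrite actMin ?groupV //.
by rewrite -(inj_eq (act_inj to h^-1%g)) actKin.
Qed.

(** The path vertices lie in distinct orbits, so at a translate of [v i] only the [i]-th term
    survives. *)
Lemma arc_vertex g h t i : (i <= n)%N -> g \in G -> h \in G ->
  arc n v g t (to (v i) h) = hat n i t * (to (v i) h == to (v i) g)%:R.
Proof.
move=> le_in gG hG; rewrite /arc (bigD1 (inord i)) //= inordK ?ltnS //.
rewrite big1 ?addr0 // => j; rewrite -val_eqE /= inordK ?ltnS // => /eqP ji.
case: eqP => [e|]; last by rewrite mulr0.
by case: ji; apply: same_orbit_vertex (esym e); rewrite // -ltnS.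
Qed.

(** The identifications between translated arcs are expressed by [J] and [K] alone; neither [v] nor
    [n] enters. This makes the realization independent of the path. *)
Lemma arc_eq g h t u : g \in G -> h \in G -> 0 <= t <= 1 -> 0 <= u <= 1 ->
  arc n v g t = arc n v h u <->
  [/\ t = u, t < 1 -> (g * h^-1)%g \in J & 0 < t -> (g * h^-1)%g \in K].
Proof.
move=> gG hG t01 u01; have [n0 stab _] := pv.
have ghG : (g * h^-1)%g \in G by rewrite groupM ?groupV.
have n0' : 0 < n%:R :> R by rewrite ltr0n.
split=> [e|[<- gJ gK]].
  have coord i : (i <= n)%N ->
      hat n i t = hat n i u * (to (v i) g == to (v i) h)%:R.
    move=> le_in; have := congr1 (fun x => x (to (v i) g)) e.
    by rewrite /= !arc_vertex // eqxx mulr1.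
  have coord' i : (i <= n)%N ->
      hat n i u = hat n i t * (to (v i) h == to (v i) g)%:R.
    move=> le_in; have := congr1 (fun x => x (to (v i) h)) e.
    by rewrite /= !arc_vertex // eqxx mulr1.
  (* Where the two translates of [v i] differ, [coord] and [coord'] force both hats to vanish;
     elsewhere the hats agree. *)
  have tu : t = u.
    apply: (hat_inj n0) => // i le_in; rewrite coord //.
    case: eqP (coord i le_in) (coord' i le_in); rewrite ?mulr1 //.
    by move=> _; rewrite mulr0 => ->; rewrite mul0r.
  subst u; split=> //.
    (* For [t < 1] the left end [v i] has coordinate [1 - s > 0], hence is fixed by [g * h^-1]; as
       [i < n], its stabilizer lies in [J]. *)
    move=> t1; have [i [s [lt_in s01 tE /(_ t1) s1]]] := unit_interval_split n0 t01.
    have := coord i (ltnW lt_in); rewrite same_vertex // stab ?(ltnW lt_in) // lt_in /=.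
    rewrite (hatE _ s01 tE) eqxx (ltn_eqF (ltnSn i)).
    by case: (_ \in J) => //= ?; exfalso; lra.
  (* For [t > 0] a vertex of positive index has positive coordinate: [v i.+1] if [s > 0], otherwise
     [v i], where [i = n * t > 0]. *)
  move=> t0; have [i [s [lt_in s01 tE _]]] := unit_interval_split n0 t01.
  have [s0|s0] := ltP 0 s.
    have := coord i.+1 lt_in; rewrite same_vertex // stab //=.
    rewrite (hatE _ s01 tE) eqxx (gtn_eqF (ltnSn i)).
    by case: (_ \in K) => //=; rewrite andbF /= => ?; exfalso; lra.
  have i0 : (0 < i)%N by rewrite -(ltr0n R); nra.
  have := coord i (ltnW lt_in); rewrite same_vertex // stab ?(ltnW lt_in) // i0 lt_in /=.
  rewrite (hatE _ s01 tE) eqxx (ltn_eqF (ltnSn i)).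
  by case: (_ \in K) => //=; rewrite andbF /= => ?; exfalso; lra.
apply/funext => w; apply: eq_bigr => -[i /= le_in] _; rewrite ltnS in le_in.
have [->|hi] := eqVneq (hat n i t) 0; first by rewrite !mul0r.
(* Hats with [i < n] vanish at [t = 1] and hats with [i > 0] vanish at [t = 0], so a non-zero hat
   meets the side conditions of [gJ] and [gK]. *)
congr (_ * _); rewrite (_ : to (v i) g = to (v i) h) //; apply/eqP.
rewrite same_vertex // stab //; apply/andP; split; apply/implyP => i1.
  apply: gJ; rewrite lt_neqAle; have /andP[_ ->] := t01; rewrite andbT.
  apply: contraNneq hi => ->; rewrite /hat mulr1 max_l //.
  have : (i.+1%:R : R) <= n%:R by rewrite ler_nat.
  by rewrite -natr1 => ?; rewrite ger0_norm; lra.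
apply: gK; rewrite lt_neqAle; have /andP[-> _] := t01; rewrite andbT.
apply: contraNneq hi => <-; rewrite /hat mulr0 max_l //.
have : (1%:R : R) <= i%:R by rewrite ler_nat.
by move=> ?; rewrite ler0_norm; lra.
Qed.

Lemma arc_path_edge i g : (i < n)%N -> g \in G -> to (v i) g != to (v i.+1) g.
Proof.
move=> lt_in gG; apply/eqP => /(same_orbit_vertex (ltnW lt_in) lt_in gG gG) /eqP.
by rewrite (ltn_eqF (ltnSn i)).
Qed.

Lemma realization_path_complex (x : {ptws V -> R}) :
  realization R (path_complex n v) x <->
  exists g t, [/\ g \in G, 0 <= t <= 1 & x = arc n v g t].
Proof.
have [n0 _ _] := pv; split.
  case=> x0 x1 /path_complexP[_ [i [g [lt_in gG]]]].
  set a := to _ _; set b := to _ _ => /fintype.subsetP sab.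
  have ab : a != b by exact: arc_path_edge.
  have xw w : w != a -> w != b -> x w = 0.
    move=> wa wb; apply/eqP/negPn/negP => xw0.
    by have := sab w; rewrite !inE xw0 (negPf wa) (negPf wb) => /(_ isT).
  have xab : x a + x b = 1.
    rewrite -x1 (bigD1 a) //= (bigD1 b) 1?eq_sym //= big1 ?addr0 // => w.
    by case/andP; exact: xw.
  have xb01 : 0 <= x b <= 1 by have := x0 a; have := x0 b; lra.
  have n0' : 0 < n%:R :> R by rewrite ltr0n.
  have : (i.+1%:R : R) <= n%:R by rewrite ler_nat.
  rewrite -natr1 => le_in.
  have i0 : 0 <= i%:R :> R by rewrite ler0n.
  (* On the [i]-th edge, the coordinate at the far end [b] is the local parameter. *)
  exists g, ((i%:R + x b) / n%:R); split=> //.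
    by rewrite divr_ge0 ?ler_pdivrMr //=; lra.
  apply/funext => w; rewrite (arcE v g w lt_in xb01); last first.
    by rewrite mulrC divfK // gt_eqF.
  rewrite -/a -/b; have [->|wa] := eqVneq w a.
    by rewrite (negPf ab) /=; lra.
  have [->|wb] := eqVneq w b; first by rewrite /=; lra.
  by rewrite xw //=; lra.
move=> [g [t [gG t01 ->]]].
have [i [s [lt_in s01 tE _]]] := unit_interval_split n0 t01.
have aE := arcE v g _ lt_in s01 tE.
have sum1 : \sum_w arc n v g t w = 1.
  under eq_bigr do rewrite aE.
  by rewrite big_split /= -!mulr_sumr !sum_delta; ring.
split=> //.
  by move=> w; rewrite aE; do 2 case: (w == _) => /=; lra.
apply/path_complexP; split.
  apply/eqP => s0; have /eqP := sum1; rewrite big1 ?(eq_sym 0) ?oner_eq0 //.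
  move=> w _; apply/eqP/negPn/negP => w0.
  by have := finset.in_set0 w; rewrite -s0 inE w0.
exists i, g; split=> //; apply/fintype.subsetP => w; rewrite !inE aE.
case: (w == _) => //=; case: (w == _) => //=.
by rewrite !mulr0 addr0 eqxx.
Qed.

Lemma path_arc_cover :
  arc_cover G (X := realization_space R to (path_complex n v)) (arc n v).
Proof.
split.
- by apply: hausdorff_product => _; exact: Rhausdorff.
- by move=> g _; exact: arc_continuous.
- exact: realization_path_complex.
- by move=> g h t gG hG; exact: arc_act.
Qed.

End WithPath.

End GPath.

(** By [arc_eq] both arc covers have the same identifications, even when the lengths [n] and [n']
    differ. *)
Lemma path_complex_homeo (R : realType) (gT : finGroupType) (G J K : {group gT})
    (V V' : finType) (to : action G V) (to' : action G V')
    (n n' : nat) (v : nat -> V) (v' : nat -> V') :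
  G_path to J K n v -> G_path to' J K n' v' ->
  exists f f', @equivariant_homeo gT G
    (realization_space R to (path_complex to n v))
    (realization_space R to' (path_complex to' n' v')) f f'.
Proof.
move=> pv pv'; apply: arc_cover_homeo (path_arc_cover R pv) (path_arc_cover R pv') _.
by move=> g h t u gG hG t01 u01; rewrite (arc_eq pv) // (arc_eq pv').
Qed.

(** * Fixed points and synthetic buildings *)

Section FixedPoints.
Local Open Scope classical_set_scope.
Local Open Scope ring_scope.
Variables (R : realType) (gT : finGroupType) (G : {group gT}).

(** An element fixing [x] stabilizes its support setwise, hence pointwise in a [G]-complex. Fixed
    subcomplexes thus become fixed point sets, to which equivariant maps restrict. *)
Lemma realization_fixedP (V : finType) (to : action G V) (X : {set {set V}})
    (P : {group gT}) (x : {ptws V -> R}) :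
  G_complex to X -> P \subset G ->
  realization R (fixed_subcomplex to P X) x <->
  realization R X x /\ forall g, g \in P -> (fun v => x (to v g^-1%g)) = x.
Proof.
move=> [_ _ regX] sPG; split.
  case=> x0 x1; rewrite inE => /andP[sX /fintype.subsetP sfix].
  split=> // g gP; apply/funext => v; have gG := fintype.subsetP sPG _ gP.
  have fixs w : x w != 0 -> to w g = w.
    by move=> xw; have := sfix w; rewrite inE => /(_ xw)/afixP/(_ _ gP).
  have [xv0|/fixs e] := eqVneq (x v) 0; last by rewrite -[in LHS]e actKin.
  rewrite xv0; apply/eqP/negPn/negP => xw; have := fixs _ xw.
  by rewrite actKVin // => vE; move: xw; rewrite -vE xv0 eqxx.
move=> [[x0 x1 sX] xfix]; split=> //; rewrite inE sX /=.
apply/fintype.subsetP => v vs; apply/afixP => g gP.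
have gG := fintype.subsetP sPG _ gP.
have /(fintype.subsetP (regX _ sX)) : g \in 'N([set v | x v != 0]%SET | to)%g.
  rewrite !inE gG; apply/fintype.subsetP => w; rewrite !inE.
  by rewrite -{2}(xfix g gP) actKin.
by move=> /astab_act; exact.
Qed.

Lemma equivariant_map_fixed (V W : finType) (toV : action G V) (toW : action G W)
    (X : {set {set V}}) (Y : {set {set W}}) (P : {group gT})
    (f : {ptws V -> R} -> {ptws W -> R}) :
  G_complex toV X -> G_complex toW Y -> P \subset G ->
  equivariant_map (X := realization_space R toV X)
    (Y := realization_space R toW Y) G f ->
  equivariant_map (X := realization_space R toV (fixed_subcomplex toV P X))
    (Y := realization_space R toW (fixed_subcomplex toW P Y)) 'N_G(P)%g f.
Proof.
move=> cX cY sPG [cf fXY fG]; split.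
- by apply: continuous_subspaceW cf => x /(realization_fixedP x cX sPG)[].
- move=> x /(realization_fixedP x cX sPG)[Xx xP].
  apply/(realization_fixedP (f x) cY sPG); split; first exact: fXY.
  move=> g gP; rewrite -[RHS](congr1 f (xP g gP)).
  by rewrite [RHS]fG //; exact: (fintype.subsetP sPG).
- move=> g x; rewrite inE => /andP[gG _] /(realization_fixedP x cX sPG)[Xx _].
  exact: fG.
Qed.

(** The homeomorphism restricts to the fixed points of each [P] and transports contractibility; the
    conditions on the simplices of [X] are supplied directly. *)
Lemma synthetic_building_homeo (p : nat) (V W : finType)
    (toV : action G V) (toW : action G W)
    (X : {set {set V}}) (Y : {set {set W}}) f f' :
  equivariant_homeo (X := realization_space R toV X)
    (Y := realization_space R toW Y) G f f' ->
  G_complex toV X -> (forall s, s \in X -> p %| #|'N(s | toV)%g|)%N ->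
  synthetic_building R p toW Y -> synthetic_building R p toV X.
Proof.
move=> [ef ef' fK f'K] cX pX [cY contr _]; split=> // P sPG pP ntP.
apply: homeo_homotopy_trans (contr P sPG pP ntP).
split; [exact: equivariant_map_fixed ef|exact: equivariant_map_fixed ef'| |].
- by move=> x /(realization_fixedP x cX sPG)[/fK].
- by move=> x /(realization_fixedP x cY sPG)[/f'K].
Qed.

(** * A vertex fixed by the whole group *)

Section FixedVertex.
Variables (V : finType) (to : action G V) (w : V).
Hypothesis wG : forall g, g \in G -> to w g = w.

Lemma vertex_contractible (A : {group gT}) : A \subset G ->
  equivariantly_contractible R A
    (realization_space R to [set [set w]]%SET).
Proof.
move=> sAG; pose d : {ptws V -> R} := fun v => (v == w)%:R.
have dX : realization R [set [set w]]%SET d.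
  by apply: realization_vertex; rewrite inE.
have dE x : realization R [set [set w]]%SET x -> d = x.
  move=> [_ x1]; rewrite inE => /eqP/setP sx.
  have x0 v : v != w -> x v = 0.
    by move=> /negPf vw; have := sx v; rewrite !inE vw => /eqP.
  apply/funext => v; rewrite /d; have [->|/x0->//] := eqVneq v w.
  by rewrite -x1 (bigD1 w) //= big1 ?addr0 // => u /x0.
exists (fun=> 0 : R), (fun=> d); split.
- split; [exact: within_cst|by []|by []].
- split; [exact: within_cst|by []|].
  move=> g x gA _; have gG := fintype.subsetP sAG _ gA; apply/funext => v.
  change (d v = d (to v g^-1%g)).
  by rewrite /d -[in RHS](inj_eq (act_inj to g)) actKVin // wG.
- by apply: homotopic_of_eq => x; exact: dE.
- by apply: homotopic_of_eq => x ->.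
Qed.

Lemma vertex_synthetic_building (p : nat) :
  (p %| #|'N([set w]%SET | to)%g|)%N ->
  synthetic_building R p to [set [set w]]%SET.
Proof.
move=> pw.
have cX : G_complex to [set [set w]]%SET.
  split.
  - split=> [|s t]; first by rewrite inE eq_sym -card_gt0 cards1.
    by rewrite !inE => /eqP->; rewrite finset.subset1 => /orP[->|/eqP->]; rewrite ?eqxx.
  - apply/fintype.subsetP => g gG; rewrite !inE gG; apply/fintype.subsetP => s.
    by rewrite !inE => /eqP ->; rewrite /= /setact imset_set1 wG.
  - move=> s; rewrite inE => /eqP->; apply/fintype.subsetP => g; rewrite !inE.
    case/andP=> gG _; rewrite gG; apply/fintype.subsetP => v; rewrite !inE => /eqP ->.
    by rewrite wG.
split=> // [P sPG pP ntP|s]; last by rewrite inE => /eqP->.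
rewrite (_ : fixed_subcomplex to P _ = [set [set w]]%SET).
  by apply: vertex_contractible; exact: subsetIl.
apply/setP => s; rewrite !inE; case: eqP => //= ->.
apply/fintype.subsetP => v; rewrite inE => /eqP->; apply/afixP => g gP.
by rewrite wG // (fintype.subsetP sPG).
Qed.

End FixedVertex.

(** * The orbit of a path as a subcomplex *)

Section PathComplex.
Variables (V : finType) (to : action G V) (Delta : {set {set V}}).
Variables (n : nat) (v : nat -> V).
Hypothesis cDelta : G_complex to Delta.
Hypothesis v_edge : forall i, (i < n)%N -> [set v i; v i.+1]%SET \in Delta.

Lemma path_complex_sub : path_complex to n v \subset Delta.
Proof.
have [[_ dc] /fintype.subsetP actD _] := cDelta.
apply/fintype.subsetP => s /path_complexP[s0 [i [g [lt_in gG sE]]]].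
apply: dc sE s0; have := actD _ gG.
rewrite !inE => /andP[_ /fintype.subsetP/(_ _ (v_edge lt_in))].
by rewrite inE /= /setact imsetU1 imset_set1.
Qed.

Lemma path_G_complex : G_complex to (path_complex to n v).
Proof.
have [[_ dc] /fintype.subsetP actD regD] := cDelta; split.
- split; first by apply/path_complexP => -[/eqP].
  move=> s t /path_complexP[s0 [i [g [lt_in gG sE]]]] ts t0.
  apply/path_complexP; split=> //; exists i, g; split=> //.
  exact: fintype.subset_trans sE.
- apply/fintype.subsetP => h hG; rewrite !inE hG; apply/fintype.subsetP => s.
  move=> /path_complexP[s0 [i [g [lt_in gG /fintype.subsetP sE]]]].
  rewrite finset.in_set; apply/path_complexP; split.
    by rewrite /= /setact imset_eq0.
  exists i, (g * h)%g; split=> //; first exact: groupM.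
  apply/fintype.subsetP => _ /imsetP[w /sE ws ->]; move: ws; rewrite !inE !actMin //.
  by case/orP=> /eqP->; rewrite eqxx ?orbT.
- by move=> s /(fintype.subsetP path_complex_sub)/regD.
Qed.

(** A simplex in the translate by [g] of the path is fixed pointwise by [H :^ g], whose order is
    that of [H]. *)
Lemma path_complex_stab (H : {group gT}) (p : nat) s : H \subset G ->
  (forall i h, (i <= n)%N -> h \in H -> to (v i) h = v i) ->
  (p %| #|H|)%N -> s \in path_complex to n v -> (p %| #|'N(s | to)%g|)%N.
Proof.
move=> sHG vH pH /path_complexP[s0 [i [g [lt_in gG /fintype.subsetP sE]]]].
rewrite -(cardJg H g) in pH; apply: dvdn_trans pH _.
apply: cardSg; apply/fintype.subsetP => _ /imsetP[h hH ->].
have hG := fintype.subsetP sHG _ hH.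
rewrite !inE groupJ //; apply/fintype.subsetP => w ws; rewrite inE.
suff -> : to w (h ^ g)%g = w by [].
have vi j : (j <= n)%N -> to (to (v j) g) (h ^ g)%g = to (v j) g.
  move=> le_jn; rewrite -actMin ?groupJ //.
  by rewrite conjgE mulKVg actMin // vH.
by have := sE w ws; rewrite !inE => /orP[] /eqP->; rewrite vi // ltnW.
Qed.

End PathComplex.
End FixedPoints.

(** * The coset graph as the orbit of a single edge *)

Section CosetPath.
Local Open Scope group_scope.
Variables (gT : finGroupType) (G J K : {group gT}).

Lemma subset_pair (T : finType) (s : {set T}) a b :
  s \subset [set a; b]%SET -> s != finset.set0 ->
  [\/ s = [set a]%SET, s = [set b]%SET | s = [set a; b]%SET].
Proof.
move=> /fintype.subsetP sab s0; have [sa|sa] := boolP (a \in s); last first.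
  apply: Or32; apply/eqP; rewrite finset.eqEsubset; apply/andP.
  have sb : s \subset [set b]%SET.
    apply/fintype.subsetP => x sx; have := sab x sx; rewrite !inE => /orP[/eqP xa|//].
    by rewrite -xa sx in sa.
  by move: sb; rewrite finset.subset1 (negPf s0) orbF => /eqP->.
have [sb|sb] := boolP (b \in s); last first.
  apply: Or31; apply/setP => x; rewrite inE; apply/idP/eqP => [sx|->//].
  have := sab x sx; rewrite !inE => /orP[/eqP//|/eqP xb].
  by rewrite -xb sx in sb.
apply: Or33; apply/setP => x; apply/idP/idP => [/sab//|].
by rewrite !inE => /orP[] /eqP->.
Qed.

(** As a path of length 1, only the values at 0 and 1 matter. *)
Definition coset_path (i : nat) : {set gT} + {set gT} :=
  if i is 0 then inl (J : {set gT}) else inr (K : {set gT}).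

(** Acting by [g] multiplies cosets on the left by [g^-1], so the edge from [x *: J] to [x *: K] is
    the translate of the base edge by [x^-1]. *)
Lemma coset_graphE :
  coset_graph G J K = path_complex (coset_action G) 1 coset_path.
Proof.
apply/setP => s; apply/idP/path_complexP.
  rewrite !inE => /orP[/orP[]|] /imsetP[x].
  - case/lcosetsP=> g gG -> ->; split; first by rewrite -card_gt0 cards1.
    exists 0%N, g^-1; rewrite groupV; split=> //=.
    by rewrite invgK finset.sub1set !inE eqxx.
  - case/lcosetsP=> g gG -> ->; split; first by rewrite -card_gt0 cards1.
    exists 0%N, g^-1; rewrite groupV; split=> //=.
    by rewrite invgK finset.sub1set !inE eqxx orbT.
  - move=> gG ->; split; first by rewrite -card_gt0 cards2.
    by exists 0%N, x^-1; rewrite groupV; split=> //=; rewrite invgK.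
move=> [s0 [i [g [lt_i gG]]]]; case: i lt_i => // _ /= sE.
rewrite -groupV in gG.
have sJ : g^-1 *: J \in lcosets J G by apply/lcosetsP; exists g^-1.
have sK : g^-1 *: K \in lcosets K G by apply/lcosetsP; exists g^-1.
case: (subset_pair sE s0) => ->; rewrite !inE.
- by rewrite imset_f.
- by rewrite imset_f ?orbT.
- by apply/orP; right; apply/imsetP; exists g^-1.
Qed.

Lemma coset_G_path : G_path (coset_action G) J K 1 coset_path.
Proof.
have mem_coset (A : {group gT}) g : (g^-1 *: A == A) = (g \in A).
  apply/eqP/idP => [e|gA]; last by rewrite lcoset_id ?groupV.
  by rewrite -groupV -e lcoset_refl.
split=> //.
  by move=> [|[|//]] g _ _ /=; rewrite ?andbT -mem_coset; apply/eqP/eqP => [[]|->].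
by move=> [|[|//]] [|[|//]].
Qed.

End CosetPath.

(** * Shortest linking paths *)

Section Connectivity.
Local Open Scope classical_set_scope.
Local Open Scope ring_scope.
Variables (R : realType) (V : finType) (X : {set {set V}}).

(* On a path in the realization, the total mass carried by a connected
   component of the 1-skeleton is continuous and takes only the values 0 and 1. *)
Lemma path_connected_connect a b : simplicial_complex X ->
  path_connected R (realization R X) ->
  [set a]%SET \in X -> [set b]%SET \in X ->
  connect [rel x y | [set x; y]%SET \in X] a b.
Proof.
move=> [_ downX] pcX aX bX; set e := [rel x y | _].
pose d x : {ptws V -> R} := fun v => (v == x)%:R.
have [gamma [cg gX g0 g1]] :=
  pcX (d a) (d b) (realization_vertex R aX) (realization_vertex R bX).
pose mass (x : {ptws V -> R}) := \sum_(v | connect e a v) x v.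
have cmass : {within [set: {ptws V -> R}], continuous mass}.
  apply: continuous_subspaceT; apply: (@continuous_big _ _ (@GRing.add R)).
    exact: add_continuous.
  by move=> v _; exact: (@proj_continuous V (fun=> R) v).
have cF := within_comp cg (fun _ _ => I) cmass.
(* The support of a point is a simplex, and any two of its vertices are adjacent; it lies wholly
   inside the component of [a] or wholly outside. *)
have mass01 x : realization R X x -> mass x = 0 \/ mass x = 1.
  move=> [x0 x1 sX]; set s := finset _ in sX.
  have joined v w : v \in s -> w \in s -> connect e v w.
    move=> vs ws; apply: connect1; apply: (downX s) => //=.
      by rewrite finset.subUset !finset.sub1set vs.
    by rewrite -card_gt0 cards2.
  have [/existsP[v /andP[vs av]]|ns] := boolP [exists v, (v \in s) && connect e a v].
    right; rewrite -x1 [in RHS](bigID (connect e a)) /=.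
    rewrite [X in _ + X]big1 ?addr0 // => w aw.
    apply/eqP/negPn/negP => xw; case/negP: aw; apply: connect_trans av _.
    by apply: joined; rewrite // inE.
  left; apply: big1 => w aw; apply/eqP/negPn/negP => xw.
  by case/existsP: ns; exists w; rewrite inE xw.
apply/negPn/negP => nab.
have F0 : mass (gamma 0) = 1.
  rewrite g0 /mass (bigD1 a) ?connect0 //= /d eqxx big1 ?addr0 // => v /andP[_].
  by move=> /negPf->.
have F1 : mass (gamma 1) = 0.
  rewrite g1 /mass big1 // => v av; rewrite /d; case: eqP av => // ->.
  by rewrite (negPf nab).
have [|c] := @IVT R (mass \o gamma) 0 1 (1 / 2) ler01 cF.
  rewrite /= F0 F1; apply/andP; split.
    by rewrite ge_min; apply/orP; right; lra.
  by rewrite le_max; apply/orP; left; lra.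
rewrite in_itv /= => /gX/mass01[]->; lra.
Qed.

End Connectivity.

(** * Cutting and splicing linking paths *)

Section LinkingPath.
Local Open Scope group_scope.
Variables (gT : finGroupType) (G J K H : {group gT}).
Hypotheses (maxJ : maximal J G) (maxK : maximal K G).
Hypothesis nconjJK : (K : {set gT}) \notin J :^: G.
Hypothesis defH : H :=: J :&: K.
Hypothesis overH : forall A : {group gT}, A \subset G -> H \proper A ->
  [\/ A :=: K, A :=: J | A :=: G].

Let sJG : J \subset G. Proof. by case/maxgroupP: maxJ => /proper_sub. Qed.
Let sKG : K \subset G. Proof. by case/maxgroupP: maxK => /proper_sub. Qed.
Let sHJ : H \subset J. Proof. by rewrite defH subsetIl. Qed.
Let sHK : H \subset K. Proof. by rewrite defH subsetIr. Qed.

Let neJK : J :=: K -> False.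
Proof.
move=> e; case/negP: nconjJK; apply/imsetP; exists 1; rewrite ?group1 //.
by rewrite conjsg1 e.
Qed.

Let nsJK : ~~ (J \subset K).
Proof.
apply/negP => sJK; case/maxgroupP: maxK => pK _; case/maxgroupP: maxJ => _ mJ.
by apply: neJK; rewrite (mJ _ pK sJK).
Qed.

Let nsKJ : ~~ (K \subset J).
Proof.
apply/negP => sKJ; case/maxgroupP: maxJ => pJ _; case/maxgroupP: maxK => _ mK.
by apply: neJK; rewrite (mK _ pJ sKJ).
Qed.

Let pHJ : H \proper J.
Proof. by rewrite finset.properEneq sHJ andbT; apply: contraNneq nsJK => <-. Qed.

Let pHK : H \proper K.
Proof. by rewrite finset.properEneq sHK andbT; apply: contraNneq nsKJ => <-. Qed.

(* [J :^ g] contains [H], so it is [J]; then [g \in J], or [J] is normal in [G],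
   in which case [G = J * K] and [K] normalizes [H = J :&: K]. *)
Lemma norm_meet_factor g : g \in G -> g \in 'N(H) ->
  exists j k, [/\ j \in J, k \in K, j \in 'N(H), k \in 'N(H) & g = j * k].
Proof.
move=> gG nHg.
have nJg : g \in 'N(J).
  have sJgG : J :^ g \subset G by rewrite -(conjGid gG) conjSg.
  have pHJg : H \proper J :^ g by rewrite -(normP nHg) properJ.
  have [e|e|e] := @overH (J :^ g)%G sJgG pHJg.
  - by case/negP: nconjJK; rewrite -e; apply/imsetP; exists g.
  - by apply/normP.
  - case/maxgroupP: maxJ => /proper_card; rewrite -(cardJg J g) -[in #|G|]e.
    by rewrite ltnn.
have [nJG|nnJG] := boolP (J <| G); last first.
  exists g, 1; rewrite group1 mulg1 nHg group1; split=> //.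
  case/maxgroupP: maxJ => pJ mJ; rewrite -[J : {set gT}](mJ ('N_G(J))%G).
  - by rewrite inE gG.
  - rewrite finset.properEneq subsetIl andbT; apply: contraNneq nnJG => e.
    by rewrite /normal sJG -e subsetIr.
  - by rewrite finset.subsetI sJG normG.
have nHK : K \subset 'N(H).
  by rewrite defH normsI ?normG // (fintype.subset_trans sKG) ?normal_norm.
have := gG; rewrite -(mulg_normal_maximal nJG maxJ sKG nsKJ).
case/mulsgP=> j k jJ kK gE; exists j, k; have nHk := fintype.subsetP nHK k kK.
by split=> //; rewrite -(groupMr _ nHk) -gE.
Qed.

Variables (V : finType) (to : action G V) (Delta : {set {set V}}).
Hypothesis cDelta : G_complex to Delta.
Hypothesis noGfix : forall x, [set x]%SET \in Delta ->
  ~ (forall g, g \in G -> to x g = x).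

(** Consecutive vertices may coincide here; minimal length rules this out later. *)
Definition linking_path n (v : nat -> V) : Prop :=
  [/\ (forall g, g \in J -> to (v 0%N) g = v 0%N),
      (forall g, g \in K -> to (v n) g = v n),
      (forall i g, (i <= n)%N -> g \in H -> to (v i) g = v i),
      (forall i, (i <= n)%N -> [set v i]%SET \in Delta)
    & (forall i, (i < n)%N -> [set v i; v i.+1]%SET \in Delta)].

Let mem_stab x g : (g \in 'C([set x]%SET | to)) = (g \in G) && (to x g == x).
Proof. by rewrite !inE finset.sub1set inE. Qed.

Let act_Delta s g : s \in Delta -> g \in G -> [set to x g | x in s]%SET \in Delta.
Proof.
case: cDelta => _ /fintype.subsetP actD _ sD /actD.
by rewrite !inE => /andP[_ /fintype.subsetP/(_ _ sD)]; rewrite inE.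
Qed.

Let act_vertex x g : [set x]%SET \in Delta -> g \in G -> [set to x g]%SET \in Delta.
Proof. by move=> /act_Delta sD /sD; rewrite imset_set1. Qed.

Let act_edge x y g : [set x; y]%SET \in Delta -> g \in G ->
  [set to x g; to y g]%SET \in Delta.
Proof. by move=> /act_Delta sD /sD; rewrite imsetU1 imset_set1. Qed.

Let normH_fix x g h : (forall h, h \in H -> to x h = x) ->
  g \in G -> g \in 'N(H) -> h \in H -> to (to x g) h = to x g.
Proof.
move=> xH gG nHg hH; have hG := fintype.subsetP sJG _ (fintype.subsetP sHJ _ hH).
rewrite -actMin // (_ : g * h = (h ^ g^-1) * g); last by rewrite conjgE invgK mulgA mulgKV.
have hgH : h ^ g^-1 \in H by rewrite memJ_norm ?groupV.
have hgG : h ^ g^-1 \in G by rewrite groupJ ?groupV.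
by rewrite actMin ?(xH _ hgH).
Qed.

(** With [g = a * k], the translates of [v i] by [a] and of [v j] by [b = k^-1] coincide, so the
    initial piece moved by [a] meets the final piece moved by [b]. As [a] is in [J] and [b] in [K],
    the ends stay put; as both normalize [H], all vertices stay fixed by [H]. *)
Lemma linking_splice n v i j g : linking_path n v ->
  (0 < i)%N -> (i < j)%N -> (j < n)%N -> g \in G -> g \in 'N(H) ->
  to (v i) g = v j -> exists w, linking_path (n - (j - i)) w.
Proof.
move=> [vJ vK vH vD vE] i0 lt_ij lt_jn gG nHg e.
have [a [k [aJ kK nHa nHk gE]]] := norm_meet_factor gG nHg.
pose b := k^-1.
have bK : b \in K by rewrite groupV.
have nHb : b \in 'N(H) by rewrite groupV.
have aG := fintype.subsetP sJG _ aJ; have bG := fintype.subsetP sKG _ bK.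
have ab : to (v i) a = to (v j) b.
  by rewrite -e gE actMin ?actKin // -groupV.
pose w m := if (m <= i)%N then to (v m) a else to (v (m + (j - i))%N) b.
exists w; split.
- by move=> h hJ; rewrite /w /= vJ ?vJ.
- move=> h hK; rewrite /w ifN; last by clear - lt_ij lt_jn; lia.
  by rewrite subnK ?vK //; clear - lt_ij lt_jn; lia.
- move=> m h le_m hH; rewrite /w; case: ifP => mi; apply: normH_fix => // h' h'H;
    apply: vH => //; clear - lt_ij lt_jn le_m mi; lia.
- move=> m le_m; rewrite /w; case: ifP => mi; apply: act_vertex => //;
    apply: vD; clear - lt_ij lt_jn le_m mi; lia.
- move=> m lt_m; rewrite /w; case: (ltngtP m i) => mi.
  + by apply: act_edge => //; apply: vE; clear - lt_ij lt_jn lt_m mi; lia.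
  + by rewrite addSn; apply: act_edge => //; apply: vE; clear - lt_ij lt_jn lt_m mi; lia.
  (* The seam: the edge leaving [w i] is the translate by [b] of the edge from [v j] to [v j.+1]. *)
  + rewrite mi ab (_ : (i.+1 + (j - i))%N = j.+1); last by clear - lt_ij; lia.
    by apply: act_edge => //; apply: vE; clear - lt_ij lt_jn lt_m mi; lia.
Qed.

Lemma shortest_linking_G_path n v : linking_path n v ->
  (forall m w, linking_path m w -> (n <= m)%N) -> G_path to J K n v.
Proof.
move=> lv minn; have [vJ vK vH vD vE] := lv.
pose S i := ('C([set v i]%SET | to))%G.
have memS i g : (g \in S i) = (g \in G) && (to (v i) g == v i) by exact: mem_stab.
have SG i : S i \subset G by apply/fintype.subsetP => g; rewrite memS => /andP[].
have SHJK i : (i <= n)%N -> [\/ S i :=: H, S i :=: J | S i :=: K].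
  move=> le_in; have sHS : H \subset S i.
    apply/fintype.subsetP => h hH; rewrite memS vH // eqxx andbT.
    exact: fintype.subsetP sJG _ (fintype.subsetP sHJ _ hH).
  have [e|ne] := eqVneq (S i : {set gT}) H; first exact: Or31.
  have pHS : H \proper S i by rewrite finset.properEneq eq_sym ne.
  have [e|e|e] := overH (SG i) pHS; [exact: Or33|exact: Or32|].
  case: (noGfix (vD _ le_in)) => g gG; have : g \in S i by rewrite e.
  by rewrite memS => /andP[_ /eqP].
have sJS : J \subset S 0%N.
  by apply/fintype.subsetP => g gJ; rewrite memS vJ // eqxx (fintype.subsetP sJG).
have sKS : K \subset S n.
  by apply/fintype.subsetP => g gK; rewrite memS vK // eqxx (fintype.subsetP sKG).
have S0 : S 0%N :=: J.
  have [e|//|e] := SHJK 0%N isT; rewrite e in sJS; last by case/negP: nsJK.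
  by case/negP: nsJK; exact: fintype.subset_trans sJS sHK.
have Sn : S n :=: K.
  have [e|e|//] := SHJK n (leqnn n); rewrite e in sKS; last by case/negP: nsKJ.
  by case/negP: nsKJ; exact: fintype.subset_trans sKS sHJ.
have n0 : (0 < n)%N.
  by rewrite lt0n; apply/eqP => n0; apply: neJK; rewrite -S0 -Sn n0.
(* An interior vertex with stabilizer [J] could start a shorter linking path, and one with
   stabilizer [K] could end one. *)
have Si i : (0 < i)%N -> (i < n)%N -> S i :=: H.
  move=> i0 lt_in; have [//|e|e] := SHJK i (ltnW lt_in).
    have : linking_path (n - i) (fun m => v (m + i)%N).
      have le_mi m : (m <= n - i)%N = (m + i <= n)%N by rewrite leq_subRL 1?addnC // ltnW.
      split=> [g|g|m g|m|m].
      - by rewrite -e memS => /andP[_ /eqP].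
      - by rewrite subnK ?(ltnW lt_in) //; exact: vK.
      - by rewrite le_mi; exact: vH.
      - by rewrite le_mi; exact: vD.
      - by rewrite ltn_subRL addnC addSn; exact: vE.
    by move/minn; rewrite leqNgt ltn_subrL i0 n0.
  have : linking_path i v.
    split=> [g|g|m g le_m|m le_m|m lt_m].
    - exact: vJ.
    - by rewrite -e memS => /andP[_ /eqP].
    - by apply: vH; exact: leq_trans le_m (ltnW lt_in).
    - by apply: vD; exact: leq_trans le_m (ltnW lt_in).
    - by apply: vE; exact: ltn_trans lt_m lt_in.
  by move/minn; rewrite leqNgt lt_in.
split=> //.
  move=> i g le_in gG; rewrite -[LHS]andTb -gG -memS.
  have [->|i0] := posnP i; first by rewrite S0 n0 andbT.
  move: le_in; rewrite leq_eqVlt => /orP[/eqP->|lt_in].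
    by rewrite Sn ltnn.
  by rewrite Si // lt_in defH inE.
suff orb i j g : (i < j)%N -> (j <= n)%N -> g \in G -> to (v i) g = v j -> False.
  move=> i j g le_in le_jn gG e; case: (ltngtP i j) => // ij.
    by case: (orb i j g).
  by case: (orb j i g^-1); rewrite ?groupV // -e actKin.
move=> lt_ij le_jn gG e.
have SJ : S j = S i :^ g :> {set gT}.
  apply/setP => h; rewrite mem_conjg !memS groupJr ?groupV //.
  have [hG|//] := boolP (h \in G); rewrite /= -e -actMin //.
  rewrite (_ : g * h = (h ^ g^-1) * g); last by rewrite conjgE invgK mulgA mulgKV.
  have hgG : h ^ g^-1 \in G by rewrite groupJ ?groupV.
  by rewrite actMin // (inj_eq (act_inj to g)).
(* By [SJ] the stabilizers are conjugate. Two end vertices would make [J] and [K] conjugate; an end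
   and an interior vertex would give [H] the order of [J] or [K]. For two interior vertices [g]
   normalizes [H], and splicing contradicts minimality. *)
have [i0|i0] := posnP i; move: (le_jn); rewrite leq_eqVlt => /orP[/eqP jn|lt_jn].
- case/negP: nconjJK; apply/imsetP; exists g => //.
  by rewrite -Sn -jn SJ i0 S0.
- have := proper_card pHJ; rewrite -(Si j) ?SJ ?i0 ?S0 ?cardJg ?ltnn //.
  by rewrite -i0.
- have := proper_card pHK; rewrite -Sn -jn SJ cardJg Si ?ltnn //.
  exact: leq_trans lt_ij le_jn.
have nHg : g \in 'N(H).
  by apply/normP; rewrite -{1}(Si i) ?(ltn_trans lt_ij) // -SJ Si // (ltn_trans i0).
have [w /minn] := linking_splice lv i0 lt_ij lt_jn gG nHg e.
by rewrite leqNgt ltn_subrL subn_gt0 lt_ij n0.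
Qed.

End LinkingPath.

(** * Existence of a linking path *)

Section LinkingPathExistence.
Local Open Scope group_scope.
Variables (gT : finGroupType) (G J K H : {group gT}) (V : finType) (to : action G V).
Variable Delta : {set {set V}}.
Hypotheses (sHJ : H \subset J) (sHK : H \subset K).
Hypothesis cDelta : simplicial_complex Delta.

Lemma fixed_subcomplex_simplicial (A : {set gT}) :
  simplicial_complex (fixed_subcomplex to A Delta).
Proof.
have [n0 dc] := cDelta; split=> [|s t]; first by rewrite inE (negPf n0).
rewrite !inE => /andP[sD sA] ts t0; rewrite (dc s) //=.
exact: fintype.subset_trans ts sA.
Qed.

Lemma fixed_vertex (A : {set gT}) : fixed_subcomplex to A Delta != finset.set0 ->
  exists2 a, [set a]%SET \in fixed_subcomplex to A Delta
           & forall g, g \in A -> to a g = a.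
Proof.
have [n0 dc] := fixed_subcomplex_simplicial A.
case/finset.set0Pn => s sX; have s0 : s != finset.set0 by apply: contraNneq n0 => <-.
have [a sa] := finset.set0Pn _ s0; exists a.
  by apply: dc sX _ _; rewrite ?finset.sub1set // -card_gt0 cards1.
by move: sX; rewrite inE => /andP[_ /fintype.subsetP/(_ _ sa)/afixP].
Qed.

Lemma linking_path_exists (R : realType) :
  fixed_subcomplex to J Delta != finset.set0 ->
  fixed_subcomplex to K Delta != finset.set0 ->
  path_connected R (realization R (fixed_subcomplex to H Delta)) ->
  exists n v, linking_path J K H to Delta n v.
Proof.
move=> /fixed_vertex[a aX aJ] /fixed_vertex[b bX bK] pcH.
have fixH x (A : {set gT}) : H \subset A ->
    [set x]%SET \in fixed_subcomplex to A Delta ->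
    [set x]%SET \in fixed_subcomplex to H Delta.
  move=> sHA; rewrite !inE !finset.sub1set => /andP[-> /afixP xA] /=.
  by apply/afixP => g /(fintype.subsetP sHA)/xA.
have cX := fixed_subcomplex_simplicial H.
(* Both end vertices lie in the fixed subcomplex of [H], whose path-connectedness yields an edge
   path there. *)
have := path_connected_connect cX pcH (fixH _ _ sHJ aX) (fixH _ _ sHK bX).
case/connectP => p /(pathP a) ep bE.
pose v i := nth a (a :: p) i.
have vE i : (i < size p)%N -> [set v i; v i.+1]%SET \in fixed_subcomplex to H Delta.
  exact: ep.
have vX i : (i <= size p)%N -> [set v i]%SET \in fixed_subcomplex to H Delta.
  case: i => [_|i lt_i]; first exact: fixH sHJ aX.
  have [_ dc] := cX; apply: dc (vE _ lt_i) _ _.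
    by rewrite finset.sub1set !inE eqxx orbT.
  by rewrite -card_gt0 cards1.
exists (size p), v; split.
- exact: aJ.
- by rewrite /v -last_nth -bE.
- move=> i g /vX; rewrite inE finset.sub1set => /andP[_ /afixP]; exact.
- by move=> i /vX; rewrite inE => /andP[].
- by move=> i /vE; rewrite inE => /andP[].
Qed.

End LinkingPathExistence.

(** * Identification of [Delta] with the orbit of a shortest linking path *)

Local Open Scope group_scope.

Theorem theorem6p11 (R : realType) (gT : finGroupType) (G : {group gT})
    (p : nat) (p_pr : prime p)
    (V : finType) (to : action G V) (Delta : {set {set V}})
    (Delta_nontriv : nontrivial_synthetic_building R to Delta)
    (Delta_min : minimal_synthetic_building R p to Delta)
    (J K H : {group gT})
    (maxJ : maximal J G) (maxK : maximal K G)
    (nconjJK : (K : {set gT}) \notin J :^: G)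
    (defH : H :=: J :&: K)
    (fixJ : fixed_subcomplex to J Delta != finset.set0)
    (fixK : fixed_subcomplex to K Delta != finset.set0)
    (fixH : path_connected R (realization R (fixed_subcomplex to H Delta)))
    (overH : forall A : {group gT}, A \subset G -> H \proper A ->
       [\/ A :=: K, A :=: J | A :=: G])
    (Gamma_building :
       synthetic_building R p (coset_action G) (coset_graph G J K)) :
  equivariant_homotopy_equivalent R G
    (realization_space R to Delta)
    (realization_space R (coset_action G) (coset_graph G J K)).
Proof.
have [[cDelta _ pDelta] minDelta] := Delta_min.
(* Such a vertex is a synthetic building by itself: if it is all of [Delta], non-triviality fails,
   otherwise minimality fails. *)
have noGfix x : [set x]%SET \in Delta -> ~ (forall g, g \in G -> to x g = x).
  move=> xD xG; have sb := vertex_synthetic_building R xG (pDelta _ xD).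
  have [e|ne] := eqVneq Delta [set [set x]]%SET.
    by apply: Delta_nontriv; rewrite e; exact: vertex_contractible xG _ _.
  by apply: minDelta sb; rewrite finset.properEneq eq_sym ne finset.sub1set.
have [sHJ sHK] : H \subset J /\ H \subset K by rewrite defH subsetIl subsetIr.
have [n [v [lv minn]]] : exists n v, linking_path J K H to Delta n v /\
    forall m w, linking_path J K H to Delta m w -> (n <= m)%N.
  have [n [v lv]] : exists n v, linking_path J K H to Delta n v.
    by case: cDelta => sc _ _; exact: linking_path_exists fixJ fixK fixH.
  have ex : exists n, `[< exists v, linking_path J K H to Delta n v >].
    by exists n; apply/asboolP; exists v.
  have [m /asboolP[w lw] minm] := ex_minnP ex; exists m, w; split=> // k u lu.
  by apply: minm; apply/asboolP; exists u.
have pv := shortest_linking_G_path maxJ maxK nconjJK defH overH cDelta noGfix lv minn.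
have [vJ vK vH vD vE] := lv.
have [f [f' hom]] := path_complex_homeo R pv (coset_G_path G J K).
rewrite -coset_graphE in hom.
have sHG : H \subset G.
  by apply: fintype.subset_trans sHJ _; case/maxgroupP: maxJ => /proper_sub.
(* The stabilizer of the base edge of the coset graph has order divisible by [p]. It fixes both
   ends, so it lies in [J :&: K = H]. *)
have pH : (p %| #|H|)%N.
  have [[_ _ reg] _ pG] := Gamma_building.
  pose e : {set {set gT} + {set gT}} := [set inl (J : {set gT}); inr (K : {set gT})]%SET.
  have eG : e \in coset_graph G J K.
    rewrite !inE; apply/orP; right; apply/imsetP; exists 1; rewrite ?group1 //.
    by rewrite !mul1g.
  apply: dvdn_trans (pG _ eG) _; apply: cardSg.
  apply: fintype.subset_trans (reg _ eG) _; apply/fintype.subsetP => g gC.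
  have gG : g \in G by move: gC; rewrite !inE => /andP[].
  have gx x : x \in e -> coset_act x g = x by exact: astab_act gC.
  have [_ stab _] := coset_G_path G J K.
  have fixg i : coset_path J K i \in e ->
      coset_action G (coset_path J K i) g == coset_path J K i.
    by move=> /gx /eqP.
  rewrite defH inE; apply/andP; split.
    by have := stab 0%N g isT gG; rewrite fixg ?inE ?eqxx //= andbT => <-.
  by have := stab 1%N g isT gG; rewrite fixg ?inE ?eqxx ?orbT //= => <-.
have cX := path_G_complex cDelta vE.
have sb : synthetic_building R p to (path_complex to n v).
  apply: synthetic_building_homeo hom cX _ Gamma_building => s.
  by apply: path_complex_stab sHG _ pH => i h le_in hH; exact: vH.
(* The orbit of the path is a subcomplex of [Delta] and a synthetic building, so by minimality it is
   not proper. *)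
have <- : path_complex to n v = Delta.
  apply/eqP; have := path_complex_sub cDelta vE.
  by rewrite finset.subEproper => /orP[//|/minDelta].
exact: homeo_homotopy_equivalent hom.
Qed.
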